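(* Let $R$ be a commutative ring with identity, let $M$ be a finitely generated multiplication $R$-module and let $N$ be a radical submodule of $M$. Then the following conditions are equivalent: (a) $N$ is a strongly 2-irreducible submodule of $M$; (b) $N$ is a 2-absorbing submodule of $M$; (c) $N$ is a 2-absorbing primary submodule of $M$; (d) $N$ is either a prime submodule of $M$ or is an intersection of exactly two prime submodules of $M$.
   Context: An $R$-module $M$ is a multiplication module if for every submodule $N$ of $M$ there is an ideal $I$ of $R$ with $N=IM$. $(N:_RM)=\{r\in R: rM\subseteq N\}$. A proper submodule $P$ of $M$ is prime if for $r\in R$, $m\in M$ with $rm\in P$, we have $m\in P$ or $r\in(P:_RM)$. The radical $\mathrm{rad}(N)$ of a submodule $N$ is the intersection of all prime submodules of $M$ containing $N$ (and is $M$ if there are none). A submodule $N\neq M$ is a radical submodule if $\mathrm{rad}(N)=N$. A proper submodule $N$ of $M$ is: strongly 2-irreducible if whenever $H_1\cap H_2\cap H_3\subseteq N$ for submodules $H_1,H_2,H_3$ of $M$, then $H_1\cap H_2\subseteq N$ or $H_2\cap H_3\subseteq N$ or $H_1\cap H_3\subseteq N$; 2-absorbing if whenever $abm\in N$ with $a,b\in R$, $m\in M$, then $am\in N$ or $bm\in N$ or $ab\in(N:_RM)$; 2-absorbing primary if whenever $abm\in N$ with $a,b\in R$, $m\in M$, then $am\in\mathrm{rad}(N)$ or $bm\in\mathrm{rad}(N)$ or $ab\in(N:_RM)$. *)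

(* Defs.v *)
From mathcomp Require Import all_boot all_algebra.
From mathcomp Require Import boolp classical_sets.

Set Implicit Arguments.
Unset Strict Implicit.
Unset Printing Implicit Defensive.

Import GRing.Theory.
Local Open Scope classical_set_scope.
Local Open Scope ring_scope.

Section Modules.
Variables (R : comPzRingType) (M : lmodType R).
Implicit Types (N P H : set M) (I : set R).

Definition submodule N : Prop := GRing.submod_closed [in N].

(* [R^o] is [R] regarded as a module over itself. Unlike
   [GRing.idealr_closed], this does not exclude the unit ideal. *)
Definition ideal I : Prop := GRing.submod_closed [in (I : set R^o)].

(* The set of finite sums of products is already a submodule when [I] is
   an ideal. *)
Definition ideal_mul_module I : set M :=
  [set x | exists (n : nat) (a : 'I_n -> R) (m : 'I_n -> M),
     (forall i, I (a i)) /\ x = \sum_(i < n) a i *: m i].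

Definition multiplication_module : Prop :=
  forall N, submodule N -> exists I, ideal I /\ N = ideal_mul_module I.

Definition finitely_generated : Prop :=
  exists (n : nat) (g : 'I_n -> M),
    forall x, exists c : 'I_n -> R, x = \sum_(i < n) c i *: g i.

Definition colon N : set R := [set r | forall m, N (r *: m)].

Definition proper_submodule N : Prop := submodule N /\ N <> setT.

Definition prime_submodule P : Prop :=
  proper_submodule P /\
  forall (r : R) (m : M), P (r *: m) -> P m \/ colon P r.

(* An empty intersection is [setT], so [rad N] is the whole module when no
   prime submodule contains [N]. *)
Definition rad N : set M :=
  \bigcap_(P in [set P | prime_submodule P /\ N `<=` P]) P.

Definition radical_submodule N : Prop := proper_submodule N /\ rad N = N.

Definition strongly_2_irreducible N : Prop :=
  proper_submodule N /\
  forall H1 H2 H3, submodule H1 -> submodule H2 -> submodule H3 ->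
    H1 `&` H2 `&` H3 `<=` N ->
    [\/ H1 `&` H2 `<=` N, H2 `&` H3 `<=` N | H1 `&` H3 `<=` N].

Definition two_absorbing N : Prop :=
  proper_submodule N /\
  forall (a b : R) (m : M), N ((a * b) *: m) ->
    [\/ N (a *: m), N (b *: m) | colon N (a * b)].

Definition two_absorbing_primary N : Prop :=
  proper_submodule N /\
  forall (a b : R) (m : M), N ((a * b) *: m) ->
    [\/ rad N (a *: m), rad N (b *: m) | colon N (a * b)].

Definition intersection_of_two_primes N : Prop :=
  exists P1 P2, [/\ prime_submodule P1, prime_submodule P2, P1 <> P2
                  & N = P1 `&` P2].

End Modules.

Arguments multiplication_module {R} M.
Arguments finitely_generated {R} M.

(* Main.v *)
(* In a multiplication module an element m outside a submodule N has a ring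
   element j with jM inside Rm but not inside N, so questions about elements of
   M reduce to the ideal Q = (N : M).  If N is radical and 2-absorbing and
   x, y, z have pairwise products in Q, then one of x, y, z is in Q: the product
   (x+y)(x+z)(y+z) lies in Q, and the pairwise products of its factors are x^2,
   y^2, z^2 modulo Q.  Hence if N is not prime, say ab is in Q with a, b outside Q, then
   (N : a) and (N : b) are distinct primes with intersection N.  Conversely,
   prime submodules of a multiplication module are strongly irreducible, and
   three submodules only have to be distributed over at most two primes.
   Finally abm in N puts aM, bM and Rm in a triple whose intersection lies in
   every prime above N. *)
From mathcomp Require Import ring.
From mathcomp Require Import all_boot all_algebra.
From mathcomp Require Import boolp classical_sets.
(* After all_algebra, whose sesquilinear forms have a [rad] of their own. *)
Require Import Defs.

Set Implicit Arguments.
Unset Strict Implicit.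
Unset Printing Implicit Defensive.

Import GRing.Theory.
Local Open Scope classical_set_scope.
Local Open Scope ring_scope.

Section Submodules.
Variables (R : comPzRingType) (M : lmodType R).
Implicit Types (N P H K : set M) (a b r x y z : R) (m u v : M).

(** * Submodules, residuals and the colon ideal *)

Lemma submoduleP N :
  submodule N <-> N 0 /\ forall r u v, N u -> N v -> N (r *: u + v).
Proof.
split=> [[N0 NL]|[N0 NL]]; split.
- by move: N0; rewrite inE.
- by move=> r u v Nu Nv; have := NL r u v; rewrite !inE; apply.
- by rewrite inE.
- by move=> r u v; rewrite !inE; apply: NL.
Qed.

Lemma submodule0 N : submodule N -> N 0.
Proof. by move/submoduleP=> []. Qed.

Lemma submoduleD N u v : submodule N -> N u -> N v -> N (u + v).
Proof. by move/submoduleP=> [_ NL] Nu Nv; rewrite -[u]scale1r; apply: NL. Qed.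

Lemma submoduleZ N r u : submodule N -> N u -> N (r *: u).
Proof.
by move/submoduleP=> [N0 NL] Nu; rewrite -[_ *: _]addr0; apply: NL.
Qed.

Lemma submoduleDl N u v : submodule N -> N u -> N (u + v) -> N v.
Proof.
move=> sN Nu Nuv; have -> : v = -1 *: u + (u + v) by rewrite scaleN1r addKr.
by apply: submoduleD => //; apply: submoduleZ.
Qed.

Lemma submodule_cyclic m : submodule [set r *: m | r in [set: R]].
Proof.
apply/submoduleP; split=> [|r _ _ [s _ <-] [t _ <-]].
  by exists 0; rewrite ?scale0r.
by exists (r * s + t); rewrite // scalerDl scalerA.
Qed.

Lemma submodule_scale a : submodule [set a *: m | m in [set: M]].
Proof.
apply/submoduleP; split=> [|r _ _ [u _ <-] [v _ <-]].
  by exists 0; rewrite ?scaler0.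
by exists (r *: u + v); rewrite // scalerDr !scalerA mulrC.
Qed.

Lemma submodule_preimage a N : submodule N -> submodule [set m | N (a *: m)].
Proof.
move=> sN; apply/submoduleP; split=> [|r u v Nu Nv] /=.
  by rewrite scaler0; apply: submodule0.
rewrite scalerDr scalerA mulrC -scalerA.
by apply: submoduleD => //; apply: submoduleZ.
Qed.

Lemma submoduleI H K : submodule H -> submodule K -> submodule (H `&` K).
Proof.
move=> /submoduleP[H0 HL] /submoduleP[K0 KL]; apply/submoduleP; split=> //.
by move=> r u v [Hu Ku] [Hv Kv]; split; [apply: HL|apply: KL].
Qed.

Lemma proper_submoduleP N :
  submodule N -> (exists m, ~ N m) -> proper_submodule N.
Proof. by move=> sN [m Nm]; split=> // NT; apply: Nm; rewrite NT. Qed.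

Lemma colonD N x y : submodule N -> colon N x -> colon N y -> colon N (x + y).
Proof. by move=> sN Nx Ny m; rewrite scalerDl; apply: submoduleD. Qed.

Lemma colonDl N x y : submodule N -> colon N x -> colon N (x + y) -> colon N y.
Proof.
move=> sN Nx Nxy m; apply: (submoduleDl sN (Nx m)).
by rewrite -scalerDl; apply: Nxy.
Qed.

Lemma colonMr N x y : colon N x -> colon N (x * y).
Proof. by move=> Nx m; rewrite -scalerA; apply: Nx. Qed.

Lemma not_colon N a : ~ colon N a -> exists m, ~ N (a *: m).
Proof. by move/existsNP. Qed.

(** If a prime [P] contains [N], then [a *: (a *: m)] in [P] forces [a *: m] into [P] in either case
    of primeness. *)
Lemma rad_colon_sqr N a : rad N = N -> colon N (a * a) -> colon N a.
Proof.
move=> radN Naa m; rewrite -radN => P [prP NP].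
have [//|] : P (a *: m) \/ colon P a; last exact.
by apply: (prP.2); rewrite scalerA; apply: NP.
Qed.

(** * Products in the colon ideal of a 2-absorbing submodule *)

Lemma two_absorbing_colon N a b c : two_absorbing N ->
  colon N (a * b * c) ->
  [\/ colon N (a * b), colon N (a * c) | colon N (b * c)].
Proof.
move=> [[sN _] absN] Nabc.
have [|Nab] := pselect (colon N (a * b)); first exact: Or31.
have [|Nac] := pselect (colon N (a * c)); first exact: Or32.
have [|Nbc] := pselect (colon N (b * c)); first exact: Or33.
have Nor m : N ((a * c) *: m) \/ N ((b * c) *: m).
  have Nabcm : N ((a * b) *: (c *: m)) by rewrite scalerA; apply: Nabc.
  by have := absN _ _ _ Nabcm; rewrite !scalerA => -[]; [left|right|].
(* By [Nor], [M] is the union of the residuals of [N] by [a * c] and [b * c]; both are proper, and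
   [u + v] lies in neither. *)
exfalso; have [u Nu] := not_colon Nac; have [v Nv] := not_colon Nbc.
have Nv' : N ((a * c) *: v) by case: (Nor v).
have Nu' : N ((b * c) *: u) by case: (Nor u).
case: (Nor (u + v)); rewrite scalerDr.
  by rewrite addrC => /(submoduleDl sN Nv').
by move/(submoduleDl sN Nu').
Qed.

Lemma two_absorbing_orthogonal N x y z : rad N = N -> two_absorbing N ->
  colon N (x * y) -> colon N (x * z) -> colon N (y * z) ->
  [\/ colon N x, colon N y | colon N z].
Proof.
move=> radN absN Nxy Nxz Nyz; have sN : submodule N by case: absN => -[].
have sqr p q r : colon N (p * q) -> colon N (p * r) -> colon N (q * r) ->
    colon N ((p + q) * (p + r)) -> colon N p.
  move=> Npq Npr Nqr Nprod; apply: (rad_colon_sqr radN).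
  apply: (@colonDl N (p * q + p * r + q * r)) => //; first by do !apply: colonD.
  by have <- : (p + q) * (p + r) = p * q + p * r + q * r + p * p by ring.
have : colon N ((x + y) * (x + z) * (y + z)).
  (* Every monomial of the expansion contains two different variables. *)
  have -> : (x + y) * (x + z) * (y + z) =
      x * y * (x + y + z) + x * z * (x + y + z) + y * z * (y + z) by ring.
  by do !apply: colonD => //; apply: colonMr.
case/(two_absorbing_colon absN) => Nprod.
- by apply: Or31; apply: (sqr x y z).
- by apply: Or32; apply: (sqr y x z); rewrite // 1?mulrC // [y + x]addrC mulrC.
- apply: Or33; apply: (sqr z x y); rewrite // 1?mulrC //.
  by rewrite mulrC [z + x]addrC [z + y]addrC.
Qed.

(** * Multiplication modules *)

Lemma multiplication_moduleP K N m : multiplication_module M ->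
  submodule K -> submodule N -> K m -> ~ N m ->
  exists2 j, ~ colon N j & colon K j.
Proof.
move=> multM sK sN Km Nm; have [I [_ KE]] := multM K sK.
(* With [K] equal to [I] times [M], each coefficient of [m] maps [M] into [K]; if all of them mapped
   [M] into [N], then [m] would be in [N]. *)
apply: contrapT => noj; apply: Nm.
move: Km; rewrite {1}KE => -[n [c [u [Ic ->]]]].
elim/big_ind: _ => [||i _]; first exact: submodule0.
  by move=> v w; apply: submoduleD.
apply: contrapT => Nci; apply: noj; exists (c i) => [Nc|w]; first exact/Nci/Nc.
rewrite KE; exists 1%N, (fun=> c i), (fun=> w); split=> //.
by rewrite big_ord1.
Qed.

Lemma multiplication_module_cyclic N m : multiplication_module M ->
  submodule N -> ~ N m ->
  exists2 j, ~ colon N j & forall u, exists r, j *: u = r *: m.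
Proof.
move=> multM sN Nm.
have [|j Nj jm] := multiplication_moduleP multM (submodule_cyclic m) sN _ Nm.
  by exists 1; rewrite ?scale1r.
by exists j => // u; have [r _ <-] := jm u; exists r.
Qed.

(** If [H] is not inside [P], some [i] outside [colon P] maps [M] into [H]; then [i *: k] is in both
    [H] and [K] for [k] in [K], so primeness puts [k] in [P]. *)
Lemma prime_strongly_irreducible P H K : multiplication_module M ->
  prime_submodule P -> submodule H -> submodule K ->
  H `&` K `<=` P -> H `<=` P \/ K `<=` P.
Proof.
move=> multM [[sP _] prP] sH sK HKP.
have [|/existsNP[h /not_implyP[Hh Ph]]] := pselect (H `<=` P); first by left.
right=> k Kk; have [i Pi Hi] := multiplication_moduleP multM sH sP Hh Ph.
have [||//] := prP i k; last by [].
by apply: HKP; split; [exact: Hi|exact: submoduleZ].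
Qed.

(** * Implications between the four conditions *)

Lemma strongly_2_irreducible_two_absorbing N :
  rad N = N -> strongly_2_irreducible N -> two_absorbing N.
Proof.
move=> radN [propN irrN]; split=> // a b m Nabm.
have [|abN|bmN|amN] := irrN _ _ _ (submodule_scale a) (submodule_scale b)
  (submodule_cyclic m).
- move=> _ [[[u _ <-] [v _ bv]] [r _ rm]]; rewrite -radN => P [[[sP _] prP] NP].
  (* Applied twice, primeness puts one of [aM], [bM], [Rm] inside [P]. *)
  have [bmP|aP] : P (b *: m) \/ colon P a by apply: prP; rewrite scalerA; exact: NP.
    have [mP|bP] := prP _ _ bmP; last by rewrite -bv.
    by rewrite -rm; apply: submoduleZ.
  exact: aP.
- apply: Or33 => u; apply: abN; split; first by exists (b *: u); rewrite // scalerA.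
  by exists (a *: u); rewrite // scalerA mulrC.
- by apply: Or32; apply: bmN; split; [exists m|exists b].
- by apply: Or31; apply: amN; split; [exists m|exists a].
Qed.

Lemma two_absorbing_residual_prime N a b : multiplication_module M ->
  rad N = N -> two_absorbing N -> ~ colon N a -> ~ colon N b ->
  colon N (a * b) -> prime_submodule [set m | N (a *: m)].
Proof.
move=> multM radN absN Na Nb Nab; have [[sN _] absNP] := absN.
have sNa := submodule_preimage a sN.
split; first by apply: proper_submoduleP => //; apply: not_colon.
move=> x m; rewrite /= scalerA => Naxm.
have [|Nam] := pselect (N (a *: m)); [by left|right].
suff Nax : colon N (a * x) by move=> u /=; rewrite scalerA.
have [//|Nxm|//] := absNP _ _ _ Naxm.
(* Choosing [j] against the residual by [a], not against [N], keeps [a * j] outside [colon N]. In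
   the triple [a * x], [a * j], [b] this leaves only [a * x]. *)
have [j Naj jm] := multiplication_module_cyclic multM sNa Nam.
have Nxj : colon N (x * j).
  move=> u; have [r ju] := jm u.
  by rewrite -scalerA ju scalerA mulrC -scalerA; apply: submoduleZ.
have [|||//|NAj|//] := @two_absorbing_orthogonal N (a * x) (a * j) b radN absN.
- have -> : a * x * (a * j) = x * j * (a * a) by ring.
  exact: colonMr.
- by rewrite mulrAC; apply: colonMr.
- by rewrite mulrAC; apply: colonMr.
- by case: Naj => u /=; rewrite scalerA; apply: NAj.
Qed.

(** An [m] outside [N] in both residuals would give a [j] such that [a], [b], [j] have pairwise
    products in [colon N] but none of them is in it. *)
Lemma two_absorbing_residual_cap N a b : multiplication_module M ->
  rad N = N -> two_absorbing N -> ~ colon N a -> ~ colon N b ->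
  colon N (a * b) -> N = [set m | N (a *: m)] `&` [set m | N (b *: m)].
Proof.
move=> multM radN absN Na Nb Nab; have sN : submodule N by case: absN => -[].
apply/seteqP; split=> [m Nm|m [/= Nam Nbm]]; first by split; apply: submoduleZ.
apply: contrapT => Nm.
have [j Nj jm] := multiplication_module_cyclic multM sN Nm.
have Ncj c : N (c *: m) -> colon N (c * j).
  move=> Ncm u; have [r ju] := jm u.
  by rewrite -scalerA ju scalerA mulrC -scalerA; apply: submoduleZ.
by case: (two_absorbing_orthogonal radN absN Nab (Ncj a Nam) (Ncj b Nbm)).
Qed.

Lemma two_absorbing_prime_or_cap N : multiplication_module M ->
  rad N = N -> two_absorbing N ->
  prime_submodule N \/ intersection_of_two_primes N.
Proof.
move=> multM radN absN; have [propN _] := absN; have [sN _] := propN.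
have [|nprN] := pselect (prime_submodule N); [by left|right].
have [a [m [Nam Nm Na]]] : exists a m, [/\ N (a *: m), ~ N m & ~ colon N a].
  apply: contrapT => noam; apply: nprN; split=> // a m Nam.
  have [|Nm] := pselect (N m); [by left|right].
  by apply: contrapT => Na; apply: noam; exists a, m.
(* The ring element [b] replaces [m]: [bM] lies in [Rm], which [a] maps into [N]. *)
have [b Nb bm] := multiplication_module_cyclic multM sN Nm.
have Nab : colon N (a * b).
  move=> u; have [r bu] := bm u.
  by rewrite -scalerA bu scalerA mulrC -scalerA; apply: submoduleZ.
have Nba : colon N (b * a) by rewrite mulrC.
exists [set m | N (a *: m)], [set m | N (b *: m)]; split.
- exact: two_absorbing_residual_prime Na Nb Nab.
- exact: two_absorbing_residual_prime Nb Na Nba.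
(* Equal residuals would turn [a * b] in [colon N] into [b * b] in [colon N]. *)
- move=> eqab; apply: Nb; apply: (rad_colon_sqr radN) => u.
  have : [set m | N (a *: m)] (b *: u) by rewrite /= scalerA; apply: Nab.
  by rewrite eqab /= scalerA.
- exact: two_absorbing_residual_cap.
Qed.

Lemma prime_cap_strongly_2_irreducible P1 P2 : multiplication_module M ->
  prime_submodule P1 -> prime_submodule P2 -> submodule (P1 `&` P2) ->
  strongly_2_irreducible (P1 `&` P2).
Proof.
move=> multM prP1 prP2 sP.
split=> [|H1 H2 H3 s1 s2 s3].
  have [[_ P1T] _] := prP1; split=> // PT; apply: P1T.
  by apply/seteqP; split=> // m; rewrite -PT => -[].
have prime3 P : prime_submodule P -> H1 `&` H2 `&` H3 `<=` P ->
    [\/ H1 `<=` P, H2 `<=` P | H3 `<=` P].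
  move=> prP; have s12 : submodule (H1 `&` H2) by apply: submoduleI.
  case/(prime_strongly_irreducible multM prP s12 s3) => [|HP]; last exact: Or33.
  by case/(prime_strongly_irreducible multM prP s1 s2); [apply: Or31|apply: Or32].
rewrite subsetI => -[/(prime3 _ prP1) + /(prime3 _ prP2)].
(* Nine cases: one of the three lies in [P1] and one in [P2]; the chosen pair includes both. *)
by case=> H1P [] H2P; [apply: Or31|apply: Or31|apply: Or33
  |apply: Or31|apply: Or31|apply: Or32|apply: Or33|apply: Or32|apply: Or32];
  move=> m [m1 m2]; split; auto.
Qed.

End Submodules.

Theorem theorem2p17 (R : comPzRingType) (M : lmodType R) (N : set M)
    (fgM : finitely_generated M) (multM : multiplication_module M)
    (radN : radical_submodule N) :
  [<-> strongly_2_irreducible N;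
       two_absorbing N;
       two_absorbing_primary N;
       prime_submodule N \/ intersection_of_two_primes N].
Proof.
have [[sN _] rN] := radN; tfae.
- exact: strongly_2_irreducible_two_absorbing.
- by rewrite /two_absorbing_primary rN.
- rewrite /two_absorbing_primary rN; exact: two_absorbing_prime_or_cap.
- case=> [prN|[P1 [P2 [prP1 prP2 _ NE]]]].
    (* A single prime is the case where both primes coincide. *)
    by rewrite -(setIid N); apply: prime_cap_strongly_2_irreducible; rewrite ?setIid.
  by move: sN; rewrite NE; apply: prime_cap_strongly_2_irreducible.
Qed.
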